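(* Let $\alpha\eqsim1$, $\beta\eqsim\lambda^{-1}$, let $f\in Z$, $z_d\in H$ be given, and let $Y_h\times Y_h^\star\subseteq Y\times Y^\star$ be a closed subspace. The problem to find $(y,p)\in Y\times Y^\star$ such that $$b(y,p;w,q)=m(w,q)\qquad\text{for all }(w,q)\in Y\times Y^\star$$ and the problem to find $(y_h,p_h)\in Y_h\times Y_h^\star$ such that $$b(y_h,p_h;w,q)=m(w,q)\qquad\text{for all }(w,q)\in Y_h\times Y_h^\star$$ admit unique solutions $(y,p)\in Y\times Y^\star$ and $(y_h,p_h)\in Y_h\times Y_h^\star$. They satisfy the quasi-optimality estimate $$|\!|\!|(y-y_h,p-p_h)|\!|\!|_\lambda\lesssim\inf_{(z_h,q_h)\in Y_h\times Y_h^\star}|\!|\!|(y-z_h,p-q_h)|\!|\!|_\lambda.$$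
   Context: All Hilbert spaces are real; $(\cdot,\cdot)_V$ and $\|\cdot\|_V$ denote the inner product and norm of a Hilbert space $V$. Let $H,X,Y,Y^\star$ be Hilbert spaces ($Y^\star$ is simply another Hilbert space, not necessarily the dual of $Y$), let $X_{\mathrm{ad}}\subseteq X$ be a closed subspace (unconstrained case), and let $Z=\boldsymbol{L}^2(\Omega_1)\times\cdots\times\boldsymbol{L}^2(\Omega_n)$, where $\Omega_1,\dots,\Omega_n$ are Lipschitz domains and each $\boldsymbol{L}^2(\Omega_j)$ is a Lebesgue space of square-integrable scalar- or vector-valued functions. Let $\mathcal{A}\colon Z\to H$, $\mathcal{B}\colon X\to Z$, $\mathcal{C}\colon X\to X$ be bounded linear operators with (Hilbert space) adjoints $\mathcal{A}^*\colon H\to Z$, $\mathcal{B}^*\colon Z\to X$, where $\mathcal{C}=\mathcal{C}^*$ and there is $\kappa>0$ with $(\mathcal{C}u,u)_X\ge\kappa\|u\|_X^2$ for all $u\in X$. Let $\mathcal{L}\colon Y\to Z$ and $\mathcal{L}^\star\colon Y^\star\to Z$ be bounded linear bijections, and let $\mathcal{I}\colon Y\to Z$, $\mathcal{I}^\star\colon Y^\star\to Z$ be bounded linear operators with $(\mathcal{L}y,\mathcal{I}^\star p)_Z=(\mathcal{I}y,\mathcal{L}^\star p)_Z$ for all $y\in Y$, $p\in Y^\star$. The cost parameter satisfies $0<\lambda\le1$. $\Pi_{X_{\mathrm{ad}}}$ denotes the orthogonal projection of $X$ onto $X_{\mathrm{ad}}$ with respect to the inner product $(u,v)_{\mathcal{C}}:=(\mathcal{C}u,v)_X$.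 For $\alpha,\beta>0$ define \begin{align*} b(y,p;w,q)&=\alpha\big(\mathcal{L}y+\mathcal{B}\Pi_{X_{\mathrm{ad}}}\lambda^{-1}\mathcal{C}^{-1}\mathcal{B}^*\mathcal{I}^\star p,\ \mathcal{L}w+\mathcal{B}\Pi_{X_{\mathrm{ad}}}\lambda^{-1}\mathcal{C}^{-1}\mathcal{B}^*\mathcal{I}^\star q\big)_Z\\ &\quad+\beta\big(\mathcal{L}^\star p-\mathcal{A}^*\mathcal{A}\mathcal{I}y,\ \mathcal{L}^\star q-\mathcal{A}^*\mathcal{A}\mathcal{I}w\big)_Z,\\ m(w,q)&=\alpha\big(f,\ \mathcal{L}w+\mathcal{B}\Pi_{X_{\mathrm{ad}}}\lambda^{-1}\mathcal{C}^{-1}\mathcal{B}^*\mathcal{I}^\star q\big)_Z+\beta\big(-\mathcal{A}^*z_d,\ \mathcal{L}^\star q-\mathcal{A}^*\mathcal{A}\mathcal{I}w\big)_Z. \end{align*} For $u\in X$, $y\in Y$ let $y_u\in Y$ and $p_y\in Y^\star$ be the unique solutions of $\mathcal{L}y_u=-\mathcal{B}u$ and $\mathcal{L}^\star p_y=\mathcal{A}^*\mathcal{A}\mathcal{I}y$. Define $$|\!|\!|(u,y,p)|\!|\!|_\lambda^2=\lambda\|u\|_X^2+\|y-y_u\|_Y^2+\lambda^{-1}\|p-p_y\|_{Y^\star}^2+\|\mathcal{A}\mathcal{I}y_u\|_H^2$$ for $(u,y,p)\in X\times Y\times Y^\star$, and $$|\!|\!|(y,p)|\!|\!|_\lambda:=|\!|\!|(\Pi_{X_{\mathrm{ad}}}\lambda^{-1}\mathcal{C}^{-1}\mathcal{B}^*\mathcal{I}^\star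 p,\,y,\,p)|\!|\!|_\lambda\quad\text{for }(y,p)\in Y\times Y^\star.$$ $A\lesssim B$ means $A\le C\,B$ with a constant $C>0$ independent of $\lambda\in(0,1]$, of the data and elements involved, and of $Y_h,Y_h^\star$ (the underlying spaces and operators being fixed; $C$ may depend on the constants in $\alpha\eqsim1$, $\beta\eqsim\lambda^{-1}$); $A\eqsim B$ means $A\lesssim B\lesssim A$. *)

(* Defs.v *)
From HB Require Import structures.
From mathcomp Require Import all_boot all_order all_algebra.
From mathcomp Require Import all_classical all_reals all_analysis.

Set Implicit Arguments.
Unset Strict Implicit.
Unset Printing Implicit Defensive.

Import Order.TTheory GRing.Theory Num.Theory.
Import numFieldNormedType.Exports.

Local Open Scope classical_set_scope.
Local Open Scope ring_scope.

HB.mixin Record CompleteNormedModule_isHilbert (R : realType) V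
    of CompleteNormedModule R V := {
  inner : V -> V -> R;
  innerC : forall u v, inner u v = inner v u;
  inner_linearl : forall w (a : R) u v,
    inner (a *: u + v) w = a * inner u w + inner v w;
  inner_norm : forall u : V, inner u u = `|u| ^+ 2
}.

#[short(type="hilbertType")]
HB.structure Definition Hilbert (R : realType) :=
  { V of CompleteNormedModule R V & CompleteNormedModule_isHilbert R V }.

Section operators.
Variables (R : realType) (V W : hilbertType R).

Definition bounded_op (T : V -> W) : Prop :=
  exists M : R, forall v, `|T v| <= M * `|v|.

(* The two operations below are total: the default value 0 is only returned
   where no solution exists, which does not happen for the inverse of a
   bijection, nor for the adjoint of a bounded linear map. *)
Definition op_inv (T : V -> W) (w : W) : V := xget 0 [set v | T v = w].

Definition adjoint (T : V -> W) (w : W) : V :=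
  xget 0 [set v | forall v', inner (T v') w = inner v' v].

End operators.

Definition closed_subspace (R : realType) (V : normedModType R) (S : set V) :
    Prop :=
  [/\ S 0, forall (a : R) u v, S u -> S v -> S (a *: u + v) & closed S].

Definition coercive_op (R : realType) (X : hilbertType R) (C : X -> X) : Prop :=
  exists2 kappa : R, 0 < kappa & forall u, kappa * `|u| ^+ 2 <= inner (C u) u.

(* Orthogonal projection onto S for the inner product inner (C u) v. *)
Definition proj_op (R : realType) (X : hilbertType R) (C : X -> X) (S : set X)
    (u : X) : X :=
  xget 0 [set v | S v /\ forall w, S w -> inner (C (u - v)) w = 0].

Section L2.
Variable R : realType.

Definition borel_rV (d : nat) := g_sigma_algebraType (@open 'rV[R]_d).

(* This characterizes mu uniquely among Borel measures. *)
Definition is_lebesgue (d : nat) (mu : {measure set (borel_rV d) -> \bar R}) :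
    Prop :=
  forall a b : 'rV[R]_d, (forall i, a 0 i <= b 0 i) ->
    mu [set x : 'rV[R]_d | forall i, a 0 i <= x 0 i < b 0 i] =
    (\prod_(i < d) (b 0 i - a 0 i))%:E.

Definition rdot (d : nat) (x y : 'rV[R]_d) : R := \sum_(i < d) x 0 i * y 0 i.

(* Near each boundary point, Omega is the strict epigraph, in the direction of
   a unit vector nu, of a Lipschitz function gamma of the coordinates orthogonal
   to nu. Boundedness of Omega is not required. The norm of 'rV[R]_d is the
   maximum norm, which yields the same Lipschitz functions as the Euclidean
   one. *)
Definition lipschitz_domain (d : nat) (Omega : set 'rV[R]_d) : Prop :=
  [/\ open Omega, connected Omega, Omega !=set0 &
   forall x0, (closure Omega `\` Omega) x0 ->
     exists (nu : 'rV[R]_d) (gamma : 'rV[R]_d -> R),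
       [/\ rdot nu nu = 1,
           forall x (t : R), gamma (x + t *: nu) = gamma x,
           exists k : R, k.-lipschitz gamma &
           \forall x \near x0, Omega x <-> gamma x < rdot nu x]].

Definition square_integrable (d : nat)
    (mu : {measure set (borel_rV d) -> \bar R}) (Omega : set (borel_rV d))
    (g : borel_rV d -> R) : Prop :=
  measurable_fun Omega g /\
  (\int[mu]_(x in Omega) (g x ^+ 2)%:E < +oo)%E.

(* Z is the Hilbert space L^2(Omega_0; R^(m_0)) x ... x
   L^2(Omega_(n-1); R^(m_(n-1))), up to isometric isomorphism: rep z j i is a
   representative of the i-th component of the j-th factor of z. *)
Definition is_L2_product (n : nat) (d m : 'I_n -> nat)
    (Omega : forall j, set 'rV[R]_(d j)) (Z : hilbertType R) : Prop :=
  exists (mu : forall j, {measure set (borel_rV (d j)) -> \bar R})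
         (rep : Z -> forall j, 'I_(m j) -> borel_rV (d j) -> R),
  [/\ forall j, is_lebesgue (mu j),
      forall z j i, square_integrable (mu j) (Omega j) (rep z j i),
      forall (a : R) z w j i,
        {ae mu j, forall x, Omega j x ->
           rep (a *: z + w) j i x = a * rep z j i x + rep w j i x},
      forall g : forall j, 'I_(m j) -> borel_rV (d j) -> R,
        (forall j i, square_integrable (mu j) (Omega j) (g j i)) ->
        exists z, forall j i,
          {ae mu j, forall x, Omega j x -> rep z j i x = g j i x} &
      forall z w, inner z w =
        \sum_(j < n) \sum_(i < m j)
          \int[mu j]_(x in Omega j) (rep z j i x * rep w j i x)].

End L2.

(* Ys, Ls, Js stand for Y^star, L^star, I^star (which are not the dual of Y nor
   the adjoints of L and I) and J for I. *)
Section control_problem.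
Variables (R : realType) (H X Y Ys Z : hilbertType R) (Xad : set X).
Variables (A : Z -> H) (B : X -> Z) (C : X -> X).
Variables (L : Y -> Z) (Ls : Ys -> Z) (J : Y -> Z) (Js : Ys -> Z).
Variables (lambda : R).

Definition control_of (p : Ys) : X :=
  proj_op C Xad (lambda^-1 *: op_inv C (adjoint B (Js p))).

Definition state_res (y : Y) (p : Ys) : Z := L y + B (control_of p).

Definition adjoint_res (y : Y) (p : Ys) : Z := Ls p - adjoint A (A (J y)).

Definition b_form (alpha beta : R) (yp wq : Y * Ys) : R :=
  alpha * inner (state_res yp.1 yp.2) (state_res wq.1 wq.2) +
  beta * inner (adjoint_res yp.1 yp.2) (adjoint_res wq.1 wq.2).

Definition m_form (alpha beta : R) (f : Z) (zd : H) (wq : Y * Ys) : R :=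
  alpha * inner f (state_res wq.1 wq.2) +
  beta * inner (- adjoint A zd) (adjoint_res wq.1 wq.2).

Definition state_of (u : X) : Y := op_inv L (- B u).

Definition adjoint_state_of (y : Y) : Ys := op_inv Ls (adjoint A (A (J y))).

Definition tnorm3 (u : X) (y : Y) (p : Ys) : R :=
  Num.sqrt (lambda * `|u| ^+ 2 + `|y - state_of u| ^+ 2 +
            lambda^-1 * `|p - adjoint_state_of y| ^+ 2 +
            `|A (J (state_of u))| ^+ 2).

Definition tnorm (yp : Y * Ys) : R := tnorm3 (control_of yp.2) yp.1 yp.2.

Definition is_solution (alpha beta : R) (f : Z) (zd : H) (S : set (Y * Ys))
    (yp : Y * Ys) : Prop :=
  S yp /\ forall wq, S wq -> b_form alpha beta yp wq = m_form alpha beta f zd wq.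

End control_problem.

(* Main.v *)
Require Import Defs.
From HB Require Import structures.
From mathcomp Require Import all_boot all_order all_algebra.
From mathcomp Require Import all_classical all_reals all_analysis.
From mathcomp Require Import ring lra.

Set Implicit Arguments.
Unset Strict Implicit.
Unset Printing Implicit Defensive.

Import Order.TTheory GRing.Theory Num.Theory.
Import numFieldNormedType.Exports.

Local Open Scope classical_set_scope.
Local Open Scope ring_scope.

(** Write [r1 = state_res y p] and [r2 = adjoint_res y p] for the two residuals,
    [u = control_of p] for the control belonging to [p] and [yu = state_of u],
    [py = adjoint_state_of y]. The form [b] is the symmetric least-squares form
    [alpha (r1, r1') + beta (r2, r2')], and everything follows from the fact
    that [b] is equivalent to the square of the triple norm, with constants
    that do not depend on [lambda] ([b_form_tnorm_equiv]).

    Indeed [r1 = L (y - yu)] and [r2 = Ls (p - py)], where [L] and [Ls] are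
    bounded and, by the bounded inverse theorem, bounded below. Hence [b] is
    equivalent to [`|y - yu|^2 + lambda^-1 `|p - py|^2], which is part of the
    squared triple norm, and the remaining part
    [lambda `|u|^2 + `|A J yu|^2] has to be bounded by it. Since [u] lies in
    [Xad] and is defined by a projection, [lambda (C u, v) = (Js p, B v)] for
    [v] in [Xad]. Taking [v = u], with [B u = - L yu] and
    [(L yu, Js p) = (J yu, Ls p)], gives ([control_energy])
    [lambda (C u, u) + `|A J yu|^2 = - (J yu, r2) - (A J yu, A J (y - yu))].
    As [`|J yu|] is bounded by a multiple of [`|u|], Young's inequality absorbs
    the factors [`|u|] and [`|A J yu|] of the right-hand side into the left-hand
    side; the weight [lambda] in front of [`|u|^2] is what produces the factor
    [lambda^-1] in front of [`|r2|^2].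

    For a fixed [lambda] the triple norm controls the norm of [Y * Ys]
    ([tnorm_definite]), so that [b] is bounded and coercive there, and the
    symmetric Lax-Milgram lemma ([sym_lax_milgram]) solves both problems. By
    Galerkin orthogonality the discrete solution is the best approximation
    with respect to [b], hence quasi-optimal for the triple norm.

    The same Lax-Milgram lemma yields the adjoints, the inverse of [C] and the
    projection onto [Xad]; the bounded inverse theorem is deduced from it and
    the Banach-Steinhaus theorem. *)

(** * Symmetric bilinear forms *)

(** Linearity is only required in the first argument; symmetry gives the
    second. *)
Definition sym_bilinear (R : realType) (E : lmodType R) (Q : E -> E -> R) :
    Prop :=
  (forall x y, Q x y = Q y x) /\
  (forall z a x y, Q (a *: x + y) z = a * Q x z + Q y z).

Section sym_bilinear_theory.
Variables (R : realType) (E : lmodType R) (Q : E -> E -> R).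
Hypothesis sbQ : sym_bilinear Q.

Lemma sbC x y : Q x y = Q y x. Proof. exact: sbQ.1. Qed.

Lemma sbDl x y z : Q (x + y) z = Q x z + Q y z.
Proof. by rewrite -[x in LHS]scale1r sbQ.2 mul1r. Qed.

Lemma sb0l z : Q 0 z = 0.
Proof. by apply: (addrI (Q 0 z)); rewrite -sbDl !addr0. Qed.

Lemma sbZl a x z : Q (a *: x) z = a * Q x z.
Proof. by rewrite -[a *: x]addr0 sbQ.2 sb0l addr0. Qed.

Lemma sbNl x z : Q (- x) z = - Q x z.
Proof. by rewrite -scaleN1r sbZl mulN1r. Qed.

Lemma sbBl x y z : Q (x - y) z = Q x z - Q y z.
Proof. by rewrite sbDl sbNl. Qed.

Lemma sbDr x y z : Q z (x + y) = Q z x + Q z y.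
Proof. by rewrite !(sbC z) sbDl. Qed.

Lemma sbZr a x z : Q z (a *: x) = a * Q z x.
Proof. by rewrite !(sbC z) sbZl. Qed.

Lemma sbNr x z : Q z (- x) = - Q z x.
Proof. by rewrite !(sbC z) sbNl. Qed.

Lemma sbBr x y z : Q z (x - y) = Q z x - Q z y.
Proof. by rewrite !(sbC z) sbBl. Qed.

Lemma sb_sqrD x y : Q (x + y) (x + y) = Q x x + 2 * Q x y + Q y y.
Proof. by rewrite sbDl !sbDr (sbC y x); ring. Qed.

Lemma sb_cauchy_schwarz x y :
  (forall z, 0 <= Q z z) -> Q x y ^+ 2 <= Q x x * Q y y.
Proof.
move=> Q0.
have [qx qy] := (Q0 x, Q0 y).
have key t : 0 <= Q x x + 2 * (t * Q x y) + t ^+ 2 * Q y y.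
  by have := Q0 (x + t *: y); rewrite sb_sqrD !sbZr sbZl mulrA -expr2.
have [y0|y0] := eqVneq (Q y y) 0; last first.
  have y1 : 0 < Q y y by rewrite lt0r y0.
  have := key (- Q x y / Q y y).
  have -> : Q x x + 2 * (- Q x y / Q y y * Q x y) +
     (- Q x y / Q y y) ^+ 2 * Q y y = (Q x x * Q y y - Q x y ^+ 2) / Q y y.
    by field.
  by rewrite pmulr_lge0 ?invr_gt0// subr_ge0.
(* If [Q y y = 0] the polynomial of [key] is affine in [t] and nonnegative,
   hence constant. *)
rewrite y0 mulr0 real_leNgt ?num_real//; apply/negP => h.
have xy0 : Q x y != 0 by rewrite -sqrf_eq0 gt_eqF.
have := key (- (Q x x + 1) / (2 * Q x y)).
rewrite y0 mulr0 addr0.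
have -> : Q x x + 2 * (- (Q x x + 1) / (2 * Q x y) * Q x y) = -1.
  by field; rewrite xy0.
by rewrite oppr_ge0 ler10.
Qed.

End sym_bilinear_theory.

(** * The symmetric Lax-Milgram lemma *)

Section lax_milgram.
Variables (R : realType) (E : completeNormedModType R) (S : set E).
Variables (Q : E -> E -> R) (l : E -> R) (c M m : R).
Hypotheses (hS : closed_subspace S) (sbQ : sym_bilinear Q) (c0 : 0 < c).
Hypotheses (Qcoer : forall x, c * `|x| ^+ 2 <= Q x x).
Hypotheses (Qbnd : forall x, Q x x <= M * `|x| ^+ 2).
Hypotheses (lL : forall a x y, l (a *: x + y) = a * l x + l y).
Hypotheses (lbnd : forall x, `|l x| <= m * `|x|).

(* The solution minimizes the energy [F] over [S]. *)
Let F x := Q x x - 2 * l x.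

Let Q0 x : 0 <= Q x x.
Proof. by apply: le_trans (Qcoer x); rewrite mulr_ge0 ?sqr_ge0// ltW. Qed.

Let has_infF : has_inf (F @` S).
Proof.
split; first by exists (F 0), 0 => //; case: hS.
exists (- (m ^+ 2 / c)) => _ [x Sx <-]; rewrite /F.
have h1 := Qcoer x; have := lbnd x; rewrite ler_norml => /andP[_ h2].
have h3 : 0 <= (c * `|x| - m) ^+ 2 / c by rewrite divr_ge0 ?sqr_ge0 ?ltW.
have e : (c * `|x| - m) ^+ 2 / c = c * `|x| ^+ 2 - 2 * (m * `|x|) + m ^+ 2 / c.
  by field; rewrite gt_eqF.
rewrite e in h3; lra.
Qed.

Let FD x w t :
  F (t *: w + x) = F x + 2 * (t * (Q x w - l w)) + t ^+ 2 * Q w w.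
Proof.
by rewrite /F lL (sb_sqrD sbQ) !(sbZl sbQ) (sbZr sbQ) (sbC sbQ w x); ring.
Qed.

(* By the parallelogram identity, almost minimizers are close together: the
   midpoint [z] of [x] and [y] cannot have an energy below the infimum. *)
Let F_dist x y e1 e2 : S x -> S y -> F x < inf (F @` S) + e1 ->
  F y < inf (F @` S) + e2 -> c * `|x - y| ^+ 2 <= 2 * (e1 + e2).
Proof.
move=> Sx Sy Fx Fy.
pose z := 2^-1 *: (x - y) + y.
have Sz : S z.
  case: hS => S0 SL _; apply: (SL) => //; rewrite -[x - y]addrC -scaleN1r.
  exact: SL.
have Fz : inf (F @` S) <= F z.
  by apply: ge_inf; [case: has_infF|exists z].
have Exy : x = 1 *: (x - y) + y by rewrite scale1r subrK.
have e := FD y (x - y) 1; rewrite -Exy in e.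
have := FD y (x - y) 2^-1; rewrite -/z => ez.
have := Qcoer (x - y).
have : 2^-1 * 2 = 1 :> R by rewrite mulVf.
rewrite e in Fx; nra.
Qed.

(** The limit of a minimizing sequence in [S] minimizes [F] over [S], and the
    first variation of [F] vanishes there. *)
Lemma sym_lax_milgram : exists x, S x /\ forall w, S w -> Q x w = l w.
Proof.
have /choice[x xP] n : exists x, S x /\ F x < inf (F @` S) + n.+1%:R^-1.
  have [_ [x Sx <-] h] := inf_adherent (@harmonic_gt0 R n) has_infF.
  by exists x.
have xC : cvg (x @ \oo).
  apply/cauchy_cvgP/cauchy_exP => e e0.
  near \oo => N; exists (x N).
  change (\forall k \near \oo, ball (x N) e (x k)).
  near=> k; rewrite -ball_normE/=.
  have kN : (N <= k)%N by near: k; exact: nbhs_infty_ge.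
  have /= h := F_dist (xP N).1 (xP k).1 (xP N).2 (xP k).2.
  have Ne : N.+1%:R^-1 < c * e ^+ 2 / 4.
    near: N; apply: near_infty_natSinv_lt (PosNum _).
    by rewrite divr_gt0// mulr_gt0// exprn_gt0.
  have kNi : k.+1%:R^-1 <= N.+1%:R^-1 :> R.
    by rewrite lef_pV2 ?posrE// ler_nat ltnS.
  rewrite -(@ltr_pXn2r _ 2) ?nnegrE//; last exact: ltW.
  rewrite -(ltr_pM2l c0); move: h Ne kNi.
  by move: N.+1%:R^-1 k.+1%:R^-1 => i j; lra.
pose y := lim (x @ \oo).
exists y; have Sy : S y.
  case: hS => _ _ cS; apply: (closed_cvg _ cS _ _ xC).
  by apply: nearW => n; exact: (xP n).1.
split => // w Sw; apply/eqP; rewrite -subr_eq0; apply/eqP.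
(* The energy does not decrease in the direction [w]. *)
have key t : 0 <= 2 * (t * (Q y w - l w)) + t ^+ 2 * Q w w.
  apply/ler_addgt0Pr => e e0.
  near \oo => n.
  have h1 : - n.+1%:R^-1 <= 2 * (t * (Q (x n) w - l w)) + t ^+ 2 * Q w w.
    have Fi : inf (F @` S) <= F (t *: w + x n).
      apply: ge_inf; first by case: has_infF.
      exists (t *: w + x n) => //; case: hS => _ + _.
      by apply => //; exact: (xP n).1.
    rewrite FD in Fi; have := (xP n).2.
    by move: n.+1%:R^-1 => i; lra.
  have ne : n.+1%:R^-1 < e / 2.
    by near: n; apply: near_infty_natSinv_lt (PosNum _); rewrite divr_gt0.
  have h2 : (`|t| * (`|M| * `|w|)) * `|x n - y| <= e / 4.
    have a0 : 0 <= `|t| * (`|M| * `|w|) by rewrite !mulr_ge0.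
    have : `|y - x n| < e / 4 / (`|t| * (`|M| * `|w|) + 1).
      near: n; move/cvgrPdist_lt : (xC); apply.
      by rewrite divr_gt0 ?divr_gt0// ltr_wpDl.
    rewrite distrC ltr_pdivlMr ?ltr_wpDl// => /ltW; apply: le_trans.
    by rewrite mulrC ler_wpM2l// lerDl.
  have h3 : `|Q (x n - y) w| <= `|M| * `|w| * `|x n - y|.
    rewrite -(@ler_pXn2r _ 2) ?nnegrE ?mulr_ge0//.
    rewrite real_normK ?num_real//.
    apply: (le_trans (sb_cauchy_schwarz sbQ _ _ Q0)).
    have -> : (`|M| * `|w| * `|x n - y|) ^+ 2 =
      (`|M| * `|x n - y| ^+ 2) * (`|M| * `|w| ^+ 2) by ring.
    by apply: ler_pM => //; apply: (le_trans (Qbnd _));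
       rewrite ler_wpM2r ?sqr_ge0 ?ler_norm.
  have : `|t * Q (x n - y) w| <= e / 4.
    by rewrite normrM; apply: le_trans h2; rewrite -!mulrA ler_wpM2l// mulrA.
  rewrite ler_norml (sbBl sbQ) => /andP[_ h4].
  by move: h1 ne; move: n.+1%:R^-1 => i; lra.
(* A quadratic polynomial without constant term and nonnegative on the line has
   no linear term: take [t] proportional to [- g]. *)
pose g := Q y w - l w.
have q0 := Q0 w.
have q1 : 0 < Q w w + 1 by rewrite ltr_wpDl.
have := key (- g / (Q w w + 1)); rewrite -/g.
have -> : 2 * (- g / (Q w w + 1) * g) + (- g / (Q w w + 1)) ^+ 2 * Q w w =
  - (g ^+ 2 * ((Q w w + 2) / (Q w w + 1) ^+ 2)).
  by field; rewrite gt_eqF.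
rewrite oppr_ge0 pmulr_lle0; last first.
  by rewrite divr_gt0 ?exprn_gt0//; lra.
by move=> g0; apply/eqP; rewrite -sqrf_eq0 eq_le g0 sqr_ge0.
Unshelve. all: by end_near. Qed.

End lax_milgram.

(** * Completeness of product spaces *)

(* Equips products with the joins of structures required by completeness. *)
HB.saturate prod.

Lemma prod_complete (R : realType) (U V : completeNormedModType R)
    (F : set_system (U * V)) : ProperFilter F -> cauchy F -> cvg F.
Proof.
move=> FF cF.
have c1 : cvg (fst @ F).
  apply: cauchy_cvg => /=; apply/cauchyP => e e0.
  have /cauchyP /(_ e e0)[x xF] := cF.
  exists x.1; apply: (@filterS _ F _ (ball x e)) => // y.
  by case.
have c2 : cvg (snd @ F).
  apply: cauchy_cvg => /=; apply/cauchyP => e e0.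
  have /cauchyP /(_ e e0)[x xF] := cF.
  exists x.2; apply: (@filterS _ F _ (ball x e)) => // y.
  by case.
apply/cvg_ex; exists (lim (fst @ F), lim (snd @ F)).
move=> A nA; have hA : F [set p : U * V | A (p.1, p.2)].
  exact: (cvg_pair c1 c2 nA).
have s : [set p : U * V | A (p.1, p.2)] `<=` A by case.
exact: (@filterS _ F _ _ _ s hA).
Qed.

HB.instance Definition _ (R : realType) (U V : completeNormedModType R) :=
  Uniform_isComplete.Build (U * V)%type (@prod_complete R U V).

(** * Inner products *)

Section inner_theory.
Variables (R : realType) (V : hilbertType R).
Implicit Types u v w : V.

Lemma inner_sym_bilinear : sym_bilinear (@inner R V).
Proof.
by split=> [x y|z a x y]; [exact: innerC|exact: inner_linearl].
Qed.

Let sbI := inner_sym_bilinear.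

Lemma innerDl u v w : inner (u + v) w = inner u w + inner v w.
Proof. exact: (sbDl sbI). Qed.

Lemma innerDr u v w : inner w (u + v) = inner w u + inner w v.
Proof. exact: (sbDr sbI). Qed.

Lemma innerBl u v w : inner (u - v) w = inner u w - inner v w.
Proof. exact: (sbBl sbI). Qed.

Lemma innerBr u v w : inner w (u - v) = inner w u - inner w v.
Proof. exact: (sbBr sbI). Qed.

Lemma innerNr u w : inner w (- u) = - inner w u.
Proof. exact: (sbNr sbI). Qed.

Lemma innerZl a u w : inner (a *: u) w = a * inner u w.
Proof. exact: (sbZl sbI). Qed.

Lemma innerZr a u w : inner w (a *: u) = a * inner w u.
Proof. exact: (sbZr sbI). Qed.

Lemma inner_linearr a u v w :
  inner w (a *: u + v) = a * inner w u + inner w v.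
Proof. by rewrite innerDr innerZr. Qed.

Lemma inner0r w : inner w 0 = 0.
Proof. by rewrite innerC (sb0l sbI). Qed.

Lemma cauchy_schwarz u v : `|inner u v| <= `|u| * `|v|.
Proof.
rewrite -(@ler_pXn2r _ 2) ?nnegrE ?mulr_ge0// real_normK ?num_real//.
rewrite exprMn -!inner_norm; apply: sb_cauchy_schwarz => // z.
by rewrite inner_norm sqr_ge0.
Qed.

Lemma inner_le u v : inner u v <= `|u| * `|v|.
Proof. exact: le_trans (ler_norm _) (cauchy_schwarz u v). Qed.

Lemma inner_eq0 u : inner u u = 0 -> u = 0.
Proof. by rewrite inner_norm => /eqP; rewrite sqrf_eq0 normr_eq0 => /eqP. Qed.

Lemma inner_inj u v : (forall w, inner u w = inner v w) -> u = v.
Proof.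
by move=> h; apply/eqP; rewrite -subr_eq0; apply/eqP/inner_eq0;
  rewrite innerBl h subrr.
Qed.

End inner_theory.

(** * Adjoints and the bounded inverse theorem *)

Lemma bounded_op_gt0 (R : realType) (V W : hilbertType R) (T : V -> W) :
  bounded_op T -> exists2 M : R, 0 < M & forall v, `|T v| <= M * `|v|.
Proof.
move=> [M hM]; exists (`|M| + 1); first by rewrite ltr_wpDl.
move=> v; apply: (le_trans (hM v)); rewrite ler_wpM2r//.
by rewrite (le_trans (ler_norm _))// lerDl.
Qed.

Lemma closed_subspace_setT (R : realType) (V : normedModType R) :
  closed_subspace [set: V].
Proof. by split => //; exact: closedT. Qed.

Section adjoint_theory.
Variables (R : realType) (V W : hilbertType R) (T : {linear V -> W}).
Hypothesis bT : bounded_op T.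

(** The Riesz representation of [fun v => inner (T v) w]. *)
Lemma adjointP v w : inner (T v) w = inner v (adjoint T w).
Proof.
have [M M0 hM] := bounded_op_gt0 bT.
suff [x hx] : exists x, forall v', inner (T v') w = inner v' x.
  by rewrite /adjoint; case: xgetP => [y _ /= ->//|/(_ x)].
have [||||x [_ hx]] := @sym_lax_milgram R V setT (@inner R V)
  (fun v' => inner (T v') w) 1 1 (M * `|w|) (@closed_subspace_setT R V)
  (inner_sym_bilinear V) ltr01.
- by move=> x; rewrite mul1r inner_norm.
- by move=> x; rewrite mul1r inner_norm.
- by move=> a x y; rewrite linearP innerDl innerZl.
- move=> x; apply: (le_trans (cauchy_schwarz _ _)).
  by rewrite mulrAC ler_wpM2r.
by exists x => v'; rewrite -(hx v' I) innerC.
Qed.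

Lemma adjoint_linear a u v :
  adjoint T (a *: u + v) = a *: adjoint T u + adjoint T v.
Proof.
apply: inner_inj => x.
rewrite innerC -adjointP !innerDr innerDl !innerZr innerZl.
by rewrite !adjointP !(innerC x).
Qed.

Lemma adjoint_norm_le M w : 0 < M -> (forall v, `|T v| <= M * `|v|) ->
  `|adjoint T w| <= M * `|w|.
Proof.
move=> M0 hM; have [->|x0] := eqVneq (adjoint T w) 0.
  by rewrite normr0 mulr_ge0// ltW.
have xp : 0 < `|adjoint T w| by rewrite normr_gt0.
rewrite -(ler_pM2l xp) -expr2 -inner_norm -adjointP.
by rewrite mulrCA mulrA (le_trans (inner_le _ _))// ler_wpM2r.
Qed.

Hypothesis surjT : forall w, exists v, T v = w.

(** The adjoint of a bounded surjection is bounded below: on the set of [w]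
    with [`|adjoint T w| <= 1] the functionals [inner w] are pointwise bounded,
    since [inner w (T v) = inner (adjoint T w) v], so that set is bounded. *)
Lemma adjoint_bounded_below :
  exists2 K : R, 0 < K & forall w, `|w| <= K * `|adjoint T w|.
Proof.
pose G : set (W -> R^o) :=
  [set g | exists2 w, `|adjoint T w| <= 1 & g = (fun w' => inner w w')].
have [||M hM] := @Banach_Steinhauss R W R^o G _ _ 1.
- move=> _ [w w1 ->]; split.
    move=> r; exists (`|w| * r) => x xr.
    by apply: (le_trans (cauchy_schwarz _ _)); rewrite ler_wpM2l.
  by move=> a x y; rewrite innerDr innerZr.
- move=> w'; have [v <-] := surjT w'; exists `|v| => _ [w w1 ->].
  rewrite innerC adjointP (le_trans (cauchy_schwarz _ _))//.
  by rewrite ler_piMr.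
exists (`|M| + 1); first by rewrite ltr_wpDl.
move=> w; have [w0|w0] := eqVneq (adjoint T w) 0.
  have [v vw] := surjT w.
  have -> : w = 0 by apply: inner_eq0; rewrite -{1}vw adjointP w0 inner0r.
  by rewrite normr0 mulr_ge0// addr_ge0.
have tp : 0 < `|adjoint T w| by rewrite normr_gt0.
have wp : 0 < `|w|.
  rewrite normr_gt0; apply: contraNneq w0 => ->; apply/eqP.
  by apply: inner_inj => x; rewrite innerC -adjointP !inner0r innerC inner0r.
pose t := `|adjoint T w|; pose w1 := t^-1 *: w.
have t0 : 0 <= t by exact: normr_ge0.
have h : `|inner w1 (`|w|^-1 *: w)| <= M.
  apply: (hM (fun w' => inner w1 w')).
    exists w1 => //.
    have -> : adjoint T w1 = t^-1 *: adjoint T w.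
      apply: inner_inj => x.
      by rewrite innerC -adjointP innerZr innerZl adjointP (innerC x).
    by rewrite normrZ gtr0_norm ?invr_gt0// mulVf ?gt_eqF.
  by rewrite normrZ gtr0_norm ?invr_gt0// mulVf ?gt_eqF.
move: h; rewrite innerZl innerZr inner_norm expr2 mulKf ?gt_eqF//.
rewrite ger0_norm ?mulr_ge0 ?invr_ge0//.
rewrite mulrC ler_pdivrMr// => /le_trans; apply.
rewrite ler_wpM2r//; apply: (le_trans (ler_norm M)).
by rewrite lerDl.
Qed.

End adjoint_theory.

Section bijection.
Variables (R : realType) (V W : hilbertType R) (T : {linear V -> W}).

Lemma op_invK w : (exists v, T v = w) -> T (op_inv T w) = w.
Proof. by move=> [v vw]; rewrite /op_inv; case: xgetP => [y _ //|/(_ v)]. Qed.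

(** Bounded inverse theorem: as [adjoint T] is bounded below, Lax-Milgram solves
    [T (adjoint T x) = T v] for [x]; then [v = adjoint T x], whence
    [`|v| ^+ 2 = inner (T v) x] and [`|x| <= K * `|v|]. *)
Lemma bounded_inverse : bounded_op T -> bijective T ->
  exists2 K : R, 0 < K & forall v, `|v| <= K * `|T v|.
Proof.
move=> bT bijT; have injT := bij_inj bijT.
have surjT w : exists v, T v = w.
  by case: bijT => g _ gK; exists (g w); exact: gK.
have [K K0 hK] := adjoint_bounded_below bT surjT.
have [M M0 hM] := bounded_op_gt0 bT.
exists K => // v.
have [||||||x [_ hx]] := @sym_lax_milgram R W setT
  (fun x y => inner (adjoint T x) (adjoint T y)) (fun w => inner (T v) w)
  (K ^- 2) (M ^+ 2) `|T v| (@closed_subspace_setT R W).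
- split=> [x y|z a x y]; first exact: innerC.
  by rewrite adjoint_linear// innerDl innerZl.
- by rewrite invr_gt0 exprn_gt0.
- move=> x; rewrite inner_norm ler_pdivrMl ?exprn_gt0// -exprMn.
  by rewrite ler_pXn2r ?nnegrE// mulr_ge0// ltW.
- move=> x; rewrite inner_norm -exprMn ler_pXn2r ?nnegrE//.
    exact: adjoint_norm_le.
  by rewrite mulr_ge0// ltW.
- by move=> a x y; rewrite innerDr innerZr.
- by move=> x; exact: cauchy_schwarz.
have vx : v = adjoint T x.
  apply: injT; apply: inner_inj => w.
  by rewrite -(hx w I) adjointP.
have [->|v0] := eqVneq v 0; first by rewrite normr0 mulr_ge0// ltW.
have vp : 0 < `|v| by rewrite normr_gt0.
rewrite -(ler_pM2r vp) -expr2 -inner_norm {2}vx -adjointP//.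
rewrite (le_trans (inner_le _ _))// mulrAC mulrC ler_wpM2r//.
by rewrite [in leRHS]vx.
Qed.

End bijection.

(** * The reduced control problem *)

(** Young's inequality, absorbing half of each term of the left-hand side. *)
Lemma young_absorb (R : realType) (kappa lambda k1 k2 a s e D : R) :
  0 < kappa -> 0 < lambda ->
  lambda * (kappa * a ^+ 2) + s ^+ 2 <= k1 * a * e + k2 * s * D ->
  lambda * a ^+ 2 + s ^+ 2 <=
    (1 + kappa^-1) *
    (k1 ^+ 2 / kappa * (lambda^-1 * e ^+ 2) + k2 ^+ 2 * D ^+ 2).
Proof.
move=> k0 l0 h.
have h1 : 0 <= (lambda * kappa * a - k1 * e) ^+ 2 / (lambda * kappa).
  by rewrite divr_ge0 ?sqr_ge0// mulr_ge0// ltW.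
have e1 : (lambda * kappa * a - k1 * e) ^+ 2 / (lambda * kappa) =
    lambda * (kappa * a ^+ 2) - 2 * (k1 * a * e) +
    k1 ^+ 2 / kappa * (lambda^-1 * e ^+ 2).
  by field; rewrite !gt_eqF.
rewrite e1 in h1.
set T := k1 ^+ 2 / kappa * _ + _.
have h3 : 0 <= (s - k2 * D) ^+ 2 by rewrite sqr_ge0.
have hT : lambda * (kappa * a ^+ 2) + s ^+ 2 <= T.
  by rewrite /T; nra.
have s2 := sqr_ge0 s; have a2 : 0 <= lambda * (kappa * a ^+ 2).
  by apply: mulr_ge0; [exact: ltW|apply: mulr_ge0; [exact: ltW|exact: sqr_ge0]].
have hs : s ^+ 2 <= T by lra.
have ha : lambda * a ^+ 2 <= kappa^-1 * T.
  by rewrite ler_pdivlMl// mulrCA; lra.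
by rewrite mulrDl mul1r; lra.
Qed.

Section control_problem.
Variables (R : realType) (H X Y Ys Z : hilbertType R) (Xad : set X).
Variables (A : {linear Z -> H}) (B : {linear X -> Z}) (C : {linear X -> X}).
Variables (L : {linear Y -> Z}) (Ls : {linear Ys -> Z}).
Variables (J : {linear Y -> Z}) (Js : {linear Ys -> Z}).
Hypotheses (hXad : closed_subspace Xad).
Hypotheses (hA : bounded_op A) (hB : bounded_op B) (hC : bounded_op C).
Hypotheses (hCadj : adjoint C =1 C) (hCcoer : coercive_op C).
Hypotheses (hL : bounded_op L) (hLs : bounded_op Ls).
Hypotheses (hLbij : bijective L) (hLsbij : bijective Ls).
Hypotheses (hJ : bounded_op J) (hJs : bounded_op Js).
Hypothesis hLJ : forall y p, inner (L y) (Js p) = inner (J y) (Ls p).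

Lemma energy_sym_bilinear : sym_bilinear (fun u v => inner (C u) v).
Proof.
split=> [x y|z a x y]; last by rewrite linearP innerDl innerZl.
by rewrite (adjointP hC) hCadj innerC.
Qed.

(** The Riesz representation for the inner product given by [C] on a closed
    subspace: it yields the inverse of [C] and the projection. *)
Lemma energy_riesz (S : set X) (x : X) : closed_subspace S ->
  exists v, S v /\ forall w, S w -> inner (C v) w = inner x w.
Proof.
move=> hS; have [kappa k0 hk] := hCcoer; have [M M0 hM] := bounded_op_gt0 hC.
have [|||v hv] := @sym_lax_milgram R X S (fun u v => inner (C u) v)
  (fun w => inner x w) kappa M `|x| hS energy_sym_bilinear k0 hk.
- move=> u; rewrite (le_trans (inner_le _ _))//.
  by rewrite expr2 mulrA ler_wpM2r.
- by move=> a u v; rewrite innerDr innerZr.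
- by move=> u; exact: cauchy_schwarz.
by exists v.
Qed.

Lemma energy_surj w : exists v, C v = w.
Proof.
have [v [_ hv]] := energy_riesz w (@closed_subspace_setT R X).
by exists v; apply: inner_inj => x; rewrite hv.
Qed.

Lemma proj_opP u : Xad (proj_op C Xad u) /\
  forall w, Xad w -> inner (C (u - proj_op C Xad u)) w = 0.
Proof.
rewrite /proj_op; case: xgetP => [y _ /= //|/= none].
have [v [Sv hv]] := energy_riesz (C u) hXad.
exfalso; apply: (none v); split => // w Sw.
by rewrite linearB innerBl hv// subrr.
Qed.

Section fixed_parameter.
Variable lambda : R.
Hypothesis l0 : 0 < lambda.

Local Notation control := (control_of Xad B C Js lambda).
Local Notation state := (state_of B L).

(** The optimality condition for the control belonging to [p]. *)
Lemma controlP p : Xad (control p) /\ forall v, Xad v ->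
  inner (C (control p)) v = lambda^-1 * inner (Js p) (B v).
Proof.
rewrite /control_of; set x := lambda^-1 *: _.
have [Su hu] := proj_opP x; split=> // v Sv.
have := hu v Sv; rewrite linearB innerBl => /eqP; rewrite subr_eq0 => /eqP <-.
rewrite /x linearZ innerZl op_invK; last exact: energy_surj.
by rewrite innerC -adjointP// innerC.
Qed.

Lemma control_linear a p q : control (a *: p + q) = a *: control p + control q.
Proof.
have [kappa k0 hk] := hCcoer.
have [_ Slin _] := hXad.
have [S1 h1] := controlP (a *: p + q).
have [S2 h2] := controlP p; have [S3 h3] := controlP q.
set d := control (a *: p + q); set s := _ + _.
have Ss : Xad s by exact: Slin.
have Sds : Xad (d - s) by rewrite addrC -scaleN1r; exact: Slin.
have : inner (C (d - s)) (d - s) = 0.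
  have Cs : C s = a *: C (control p) + C (control q) by rewrite /s linearP.
  rewrite linearB innerBl Cs h1// innerDl innerZl h2// h3//.
  by rewrite linearP innerDl innerZl; ring.
move=> e; have := hk (d - s); rewrite e pmulr_rle0// => le0.
apply/eqP; rewrite -subr_eq0 -normr_eq0 -sqrf_eq0 eq_le le0.
exact: sqr_ge0.
Qed.

Lemma control_bounded :
  exists2 M : R, 0 < M & forall p, `|control p| <= M * `|p|.
Proof.
have [kappa k0 hk] := hCcoer.
have [MB MB0 hMB] := bounded_op_gt0 hB.
have [MJ MJ0 hMJ] := bounded_op_gt0 hJs.
exists (kappa^-1 * (lambda^-1 * (MJ * MB))).
  by rewrite !mulr_gt0 ?invr_gt0.
move=> p; have [Su /(_ _ Su) hu] := controlP p.
set u := control p in Su hu *.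
have [->|u0] := eqVneq u 0; first by rewrite normr0 !mulr_ge0// ltW// invr_gt0.
have up : 0 < `|u| by rewrite normr_gt0.
have key : kappa * `|u| ^+ 2 <= lambda^-1 * (MJ * `|p| * (MB * `|u|)).
  rewrite (le_trans (hk u))// hu ler_pM2l ?invr_gt0//.
  by rewrite (le_trans (inner_le _ _))// ler_pM.
rewrite -(ler_pM2r up) -expr2 -(ler_pM2l k0); apply: (le_trans key).
rewrite le_eqVlt; apply/orP; left; apply/eqP.
by field; rewrite !gt_eqF.
Qed.

Lemma state_ofP u : L (state u) = - B u.
Proof. by apply: op_invK; case: hLbij => g _ gK; exists (g (- B u)). Qed.

Lemma adjoint_state_ofP y :
  Ls (adjoint_state_of A Ls J y) = adjoint A (A (J y)).
Proof. by apply: op_invK; case: hLsbij => g _ gK; eexists; exact: gK. Qed.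

Lemma state_resE y p :
  state_res Xad B C L Js lambda y p = L (y - state (control p)).
Proof. by rewrite linearB state_ofP opprK. Qed.

Lemma adjoint_resE y p :
  adjoint_res A Ls J y p = Ls (p - adjoint_state_of A Ls J y).
Proof. by rewrite linearB adjoint_state_ofP. Qed.

(** Testing the optimality condition with the control itself and passing to the
    adjoint equation by the duality of the two state operators; the term
    [inner (A (J (state u))) (A (J y))] yields a square with the good sign, up
    to the state residual. *)
Lemma control_energy y p :
  lambda * inner (C (control p)) (control p) +
    `|A (J (state (control p)))| ^+ 2 =
  - inner (J (state (control p))) (adjoint_res A Ls J y p)
  - inner (A (J (state (control p)))) (A (J (y - state (control p)))).
Proof.
have [Su /(_ _ Su) ->] := controlP p.
have -> : B (control p) = - L (state (control p)).
  by rewrite state_ofP opprK.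
set yu := state (control p).
rewrite mulVKf ?gt_eqF// innerNr innerC hLJ /adjoint_res.
rewrite innerBr -adjointP// [J (y - yu)]linearB [A (_ - _)]linearB.
rewrite innerBr inner_norm.
by ring.
Qed.

Lemma state_res_linear a y1 p1 y2 p2 :
  state_res Xad B C L Js lambda (a *: y1 + y2) (a *: p1 + p2) =
  a *: state_res Xad B C L Js lambda y1 p1 +
  state_res Xad B C L Js lambda y2 p2.
Proof.
by rewrite /state_res control_linear !linearP scalerDr !addrA; congr (_ + _);
  rewrite addrAC.
Qed.

Lemma adjoint_res_linear a y1 p1 y2 p2 :
  adjoint_res A Ls J (a *: y1 + y2) (a *: p1 + p2) =
  a *: adjoint_res A Ls J y1 p1 + adjoint_res A Ls J y2 p2.
Proof.
rewrite /adjoint_res !linearP adjoint_linear// scalerBr opprD !addrA.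
by congr (_ + _); rewrite addrAC.
Qed.

Lemma b_form_sym_bilinear alpha beta :
  sym_bilinear (b_form Xad A B C L Ls J Js lambda alpha beta).
Proof.
split=> [x y|z a x y]; rewrite /b_form.
  by rewrite innerC [in X in _ + X]innerC.
have -> : (a *: x + y).1 = a *: x.1 + y.1 by [].
have -> : (a *: x + y).2 = a *: x.2 + y.2 by [].
rewrite state_res_linear adjoint_res_linear !inner_linearl.
by ring.
Qed.

Lemma m_form_linear alpha beta f zd a x y :
  m_form Xad A B C L Ls J Js lambda alpha beta f zd (a *: x + y) =
  a * m_form Xad A B C L Ls J Js lambda alpha beta f zd x +
  m_form Xad A B C L Ls J Js lambda alpha beta f zd y.
Proof.
rewrite /m_form.
have -> : (a *: x + y).1 = a *: x.1 + y.1 by [].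
have -> : (a *: x + y).2 = a *: x.2 + y.2 by [].
rewrite state_res_linear adjoint_res_linear !inner_linearr.
by ring.
Qed.

Lemma b_formE alpha beta x :
  b_form Xad A B C L Ls J Js lambda alpha beta x x =
  alpha * `|state_res Xad B C L Js lambda x.1 x.2| ^+ 2 +
  beta * `|adjoint_res A Ls J x.1 x.2| ^+ 2.
Proof. by rewrite /b_form !inner_norm. Qed.

Lemma tnorm_sqr x :
  tnorm Xad A B C L Ls J Js lambda x ^+ 2 =
  lambda * `|control x.2| ^+ 2 + `|x.1 - state (control x.2)| ^+ 2 +
  lambda^-1 * `|x.2 - adjoint_state_of A Ls J x.1| ^+ 2 +
  `|A (J (state (control x.2)))| ^+ 2.
Proof.
rewrite sqr_sqrtr// !addr_ge0 ?sqr_ge0// mulr_ge0 ?sqr_ge0// ltW//.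
by rewrite invr_gt0.
Qed.


Lemma tnorm_ge0 x : 0 <= tnorm Xad A B C L Ls J Js lambda x.
Proof. exact: sqrtr_ge0. Qed.

(** For a fixed parameter, the residuals depend continuously on the pair of
    state and adjoint state. *)
Lemma residuals_bounded : exists2 M : R, 0 < M & forall x : Y * Ys,
  `|state_res Xad B C L Js lambda x.1 x.2| <= M * `|x| /\
  `|adjoint_res A Ls J x.1 x.2| <= M * `|x|.
Proof.
have [MA MA0 hMA] := bounded_op_gt0 hA.
have [MB MB0 hMB] := bounded_op_gt0 hB.
have [ML ML0 hML] := bounded_op_gt0 hL.
have [MLs MLs0 hMLs] := bounded_op_gt0 hLs.
have [MJ MJ0 hMJ] := bounded_op_gt0 hJ.
have [Mu Mu0 hMu] := control_bounded.
have x1 (x : Y * Ys) : `|x.1| <= `|x| by rewrite prod_normE le_max lexx.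
have x2 (x : Y * Ys) : `|x.2| <= `|x| by rewrite prod_normE le_max lexx orbT.
exists (ML + MB * Mu + (MLs + MA * (MA * MJ))).
  by rewrite !addr_gt0 ?mulr_gt0.
have le_comp (a b c e f : R) : 0 <= a -> e <= a * b -> b <= c * f ->
    e <= a * c * f.
  by move=> a0 eb bf; rewrite (le_trans eb)// -mulrA ler_wpM2l.
move=> x; split.
  apply: (@le_trans _ _ ((ML + MB * Mu) * `|x|)); last first.
    by rewrite ler_wpM2r// lerDl ltW// !addr_gt0 ?mulr_gt0.
  rewrite mulrDl (le_trans (ler_normD _ _))// lerD//.
    by rewrite (le_trans (hML _))// ler_wpM2l// ltW.
  apply: (le_comp) (hMB _) _; first exact: ltW.
  by rewrite (le_trans (hMu _))// ler_wpM2l// ltW.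
apply: (@le_trans _ _ ((MLs + MA * (MA * MJ)) * `|x|)); last first.
  by rewrite ler_wpM2r// lerDr ltW// !addr_gt0 ?mulr_gt0.
rewrite mulrDl (le_trans (ler_normB _ _))// lerD//.
  by rewrite (le_trans (hMLs _))// ler_wpM2l// ltW.
apply: (le_comp) (adjoint_norm_le hA _ MA0 hMA) _; first exact: ltW.
apply: (le_comp) (hMA _) _; first exact: ltW.
by rewrite (le_trans (hMJ _))// ler_wpM2l// ltW.
Qed.

(** For a fixed parameter the triple norm is definite: it controls the norm of
    the pair of state and adjoint state. *)
Lemma tnorm_definite : lambda <= 1 -> exists2 c : R, 0 < c &
  forall x : Y * Ys, `|x| <= c * tnorm Xad A B C L Ls J Js lambda x.
Proof.
move=> l1.
have [MA MA0 hMA] := bounded_op_gt0 hA.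
have [MB MB0 hMB] := bounded_op_gt0 hB.
have [MJ MJ0 hMJ] := bounded_op_gt0 hJ.
have [KL KL0 hKL] := bounded_inverse hL hLbij.
have [KLs KLs0 hKLs] := bounded_inverse hLs hLsbij.
pose cy := 1 + KL * (MB * lambda^-1).
pose cp := 1 + KLs * (MA * (MA * (MJ * cy))).
have li0 : 0 < lambda^-1 by rewrite invr_gt0.
have li1 : 1 <= lambda^-1 by rewrite invf_ge1.
have cy0 : 0 < cy by rewrite addr_gt0 ?mulr_gt0.
have cp0 : 0 < cp by rewrite addr_gt0 ?mulr_gt0.
exists (cy + cp); first by rewrite addr_gt0.
move=> x; have := tnorm_sqr x; have := tnorm_ge0 x.
set N := tnorm _ _ _ _ _ _ _ _ _ _; set u := control x.2.
set yu := state u; set py := adjoint_state_of _ _ _ _ => N0 hN.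
have q1 : 0 <= lambda * `|u| ^+ 2 by rewrite mulr_ge0 ?sqr_ge0// ltW.
have q2 : 0 <= `|x.1 - yu| ^+ 2 by exact: sqr_ge0.
have q3 : 0 <= lambda^-1 * `|x.2 - py| ^+ 2 by rewrite mulr_ge0 ?sqr_ge0// ltW.
have q4 : 0 <= `|A (J yu)| ^+ 2 by exact: sqr_ge0.
have hy : `|x.1 - yu| <= N.
  by rewrite -(@ler_pXn2r _ 2) ?nnegrE// hN; lra.
have hp : `|x.2 - py| <= N.
  rewrite -(@ler_pXn2r _ 2) ?nnegrE// hN.
  by have := ler_peMl (sqr_ge0 `|x.2 - py|) li1; lra.
have hu : `|u| <= lambda^-1 * N.
  rewrite ler_pdivlMl// -(@ler_pXn2r _ 2) ?nnegrE//; last first.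
    by rewrite mulr_ge0// ltW.
  rewrite hN.
  rewrite exprMn expr2 -mulrA.
  by have := ler_piMl q1 l1; lra.
have ny : `|x.1| <= cy * N.
  rewrite -[x.1](subrK yu) (le_trans (ler_normD _ _))// mulrDl mul1r lerD//.
  rewrite (le_trans (hKL _))// state_ofP normrN -!mulrA ler_pM2l//.
  by rewrite (le_trans (hMB _))// ler_pM2l.
have np : `|x.2| <= cp * N.
  rewrite -[x.2](subrK py) (le_trans (ler_normD _ _))// mulrDl mul1r lerD//.
  rewrite (le_trans (hKLs _))// adjoint_state_ofP -!mulrA ler_pM2l//.
  rewrite (le_trans (adjoint_norm_le hA _ MA0 hMA))// ler_pM2l//.
  rewrite (le_trans (hMA _))// ler_pM2l//.
  by rewrite (le_trans (hMJ _))// ler_pM2l.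
rewrite prod_normE ge_max mulrDl; apply/andP; split.
  by rewrite (le_trans ny)// lerDl mulr_ge0// ltW.
by rewrite (le_trans np)// lerDr mulr_ge0// ltW.
Qed.

End fixed_parameter.

(** * Stability and quasi-optimality *)

(** Stability, uniform in the parameter: the least-squares form is equivalent
    to the squared triple norm. *)
Lemma b_form_tnorm_equiv (a1 a2 b1 b2 : R) :
  0 < a1 -> 0 < a2 -> 0 < b1 -> 0 < b2 ->
  exists K1 K2 : R, [/\ 0 < K1, 0 < K2 & forall lambda alpha beta : R,
    0 < lambda <= 1 -> a1 <= alpha <= a2 ->
    b1 * lambda^-1 <= beta <= b2 * lambda^-1 -> forall x,
    b_form Xad A B C L Ls J Js lambda alpha beta x x <=
      K1 * tnorm Xad A B C L Ls J Js lambda x ^+ 2 /\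
    tnorm Xad A B C L Ls J Js lambda x ^+ 2 <=
      K2 * b_form Xad A B C L Ls J Js lambda alpha beta x x].
Proof.
move=> ha1 ha2 hb1 hb2.
have [kappa k0 hk] := hCcoer.
have [MA MA0 hMA] := bounded_op_gt0 hA.
have [MB MB0 hMB] := bounded_op_gt0 hB.
have [MJ MJ0 hMJ] := bounded_op_gt0 hJ.
have [ML ML0 hML] := bounded_op_gt0 hL.
have [MLs MLs0 hMLs] := bounded_op_gt0 hLs.
have [KL KL0 hKL] := bounded_inverse hL hLbij.
have [KLs KLs0 hKLs] := bounded_inverse hLs hLsbij.
pose k1 := MJ * (KL * MB); pose k2 := MA * MJ.
(* [ce] and [cr] are the factors of [beta * `|r2| ^+ 2] and
   [alpha * `|r1| ^+ 2] in the bound of the triple norm. *)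
pose ce := ((1 + kappa^-1) * (k1 ^+ 2 / kappa) + KLs ^+ 2) / b1.
pose cr := ((1 + kappa^-1) * k2 ^+ 2 + 1) * KL ^+ 2 / a1.
have ki0 : 0 < kappa^-1 by rewrite invr_gt0.
have kk0 : 0 < 1 + kappa^-1 by rewrite addr_gt0.
have k10 : 0 < k1 by rewrite !mulr_gt0.
have k20 : 0 < k2 by rewrite !mulr_gt0.
have ce0 : 0 < ce.
  by rewrite divr_gt0// addr_gt0 ?exprn_gt0// !mulr_gt0 ?exprn_gt0.
have cr0 : 0 < cr.
  by rewrite divr_gt0// mulr_gt0 ?exprn_gt0// addr_gt0// !mulr_gt0 ?exprn_gt0.
exists (a2 * ML ^+ 2 + b2 * MLs ^+ 2), (ce + cr); split.
- by rewrite addr_gt0// mulr_gt0// exprn_gt0.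
- by rewrite addr_gt0.
move=> lambda alpha beta /andP[l0 l1] /andP[al1 al2] /andP[be1 be2] x.
have li0 : 0 < lambda^-1 by rewrite invr_gt0.
have al0 : 0 < alpha by exact: lt_le_trans al1.
have be0 : 0 < beta by apply: lt_le_trans be1; rewrite mulr_gt0.
have := tnorm_sqr l0 x; have := b_formE lambda alpha beta x.
have := control_energy l0 x.1 x.2.
have := adjoint_resE x.1 x.2; have := state_resE lambda x.1 x.2.
set u := control_of _ _ _ _ _ _; set yu := state_of _ _ _.
set py := adjoint_state_of _ _ _ _.
set r1 := state_res _ _ _ _ _ _ _ _; set r2 := adjoint_res _ _ _ _ _.
move=> r1E r2E energy -> ->.
have sqle (s t : R) : 0 <= s -> s <= t -> s ^+ 2 <= t ^+ 2.
  by move=> s0 st; rewrite ler_pXn2r ?nnegrE// (le_trans s0).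
have r1_le : `|r1| ^+ 2 <= ML ^+ 2 * `|x.1 - yu| ^+ 2.
  by rewrite -exprMn r1E sqle.
have r2_le : `|r2| ^+ 2 <= MLs ^+ 2 * `|x.2 - py| ^+ 2.
  by rewrite -exprMn r2E sqle.
have D_le : `|x.1 - yu| ^+ 2 <= KL ^+ 2 * `|r1| ^+ 2.
  by rewrite -exprMn r1E sqle.
have P_le : `|x.2 - py| ^+ 2 <= KLs ^+ 2 * `|r2| ^+ 2.
  by rewrite -exprMn r2E sqle.
have q1 : 0 <= lambda * `|u| ^+ 2 by rewrite mulr_ge0 ?sqr_ge0// ltW.
have q2 : 0 <= `|x.1 - yu| ^+ 2 by exact: sqr_ge0.
have q3 : 0 <= lambda^-1 * `|x.2 - py| ^+ 2 by rewrite mulr_ge0 ?sqr_ge0// ltW.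
have q4 : 0 <= `|A (J yu)| ^+ 2 by exact: sqr_ge0.
have q5 : 0 <= alpha * `|r1| ^+ 2 by rewrite mulr_ge0 ?sqr_ge0// ltW.
have q6 : 0 <= beta * `|r2| ^+ 2 by rewrite mulr_ge0 ?sqr_ge0// ltW.
split.
  have h1 : alpha * `|r1| ^+ 2 <= a2 * ML ^+ 2 * `|x.1 - yu| ^+ 2.
    by rewrite -mulrA ler_pM ?sqr_ge0// ltW.
  have h2 : beta * `|r2| ^+ 2 <=
      b2 * MLs ^+ 2 * (lambda^-1 * `|x.2 - py| ^+ 2).
    apply: (@le_trans _ _ (b2 * lambda^-1 * (MLs ^+ 2 * `|x.2 - py| ^+ 2))).
      by rewrite ler_pM ?sqr_ge0// ltW.
    by rewrite le_eqVlt; apply/orP; left; apply/eqP; ring.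
  have c1 : 0 < a2 * ML ^+ 2 by rewrite mulr_gt0// exprn_gt0.
  have c2 : 0 < b2 * MLs ^+ 2 by rewrite mulr_gt0// exprn_gt0.
  move: h1 h2 c1 c2; move: (a2 * ML ^+ 2) (b2 * MLs ^+ 2) => c1 c2.
  move: q1 q2 q3 q4; move: (lambda * _) (`|x.1 - yu| ^+ 2) => s1 s2.
  move: (lambda^-1 * _) (`|A (J yu)| ^+ 2) => s3 s4.
  by nra.
have Jyu : `|J yu| <= k1 * `|u|.
  rewrite (le_trans (hMJ _))// -!mulrA ler_pM2l//.
  rewrite (le_trans (hKL _))// state_ofP normrN -?mulrA ler_pM2l//.
have AJD : `|A (J (x.1 - yu))| <= k2 * `|x.1 - yu|.
  by rewrite (le_trans (hMA _))// -mulrA ler_pM2l.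
have young : lambda * `|u| ^+ 2 + `|A (J yu)| ^+ 2 <=
    (1 + kappa^-1) * (k1 ^+ 2 / kappa * (lambda^-1 * `|r2| ^+ 2) +
                      k2 ^+ 2 * `|x.1 - yu| ^+ 2).
  apply: young_absorb => //.
  have h1 : lambda * (kappa * `|u| ^+ 2) <= lambda * inner (C u) u.
    by rewrite ler_pM2l.
  have h2 : - inner (J yu) r2 <= k1 * `|u| * `|r2|.
    rewrite (le_trans (ler_norm _))// normrN (le_trans (cauchy_schwarz _ _))//.
    by rewrite ler_wpM2r.
  have h3 : - inner (A (J yu)) (A (J (x.1 - yu))) <=
      k2 * `|A (J yu)| * `|x.1 - yu|.
    rewrite (le_trans (ler_norm _))// normrN (le_trans (cauchy_schwarz _ _))//.
    by rewrite mulrAC mulrC ler_wpM2r.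
  by lra.
have h1 : lambda^-1 * `|r2| ^+ 2 <= b1^-1 * (beta * `|r2| ^+ 2).
  by rewrite ler_pdivlMl// mulrA ler_wpM2r ?sqr_ge0.
have h2 : `|r1| ^+ 2 <= a1^-1 * (alpha * `|r1| ^+ 2).
  by rewrite ler_pdivlMl// ler_wpM2r ?sqr_ge0.
have h3 : lambda^-1 * `|x.2 - py| ^+ 2 <= KLs ^+ 2 * (lambda^-1 * `|r2| ^+ 2).
  by rewrite [leRHS]mulrCA ler_pM2l.
have h4 : (1 + kappa^-1) * (k1 ^+ 2 / kappa * (lambda^-1 * `|r2| ^+ 2)) +
    KLs ^+ 2 * (lambda^-1 * `|r2| ^+ 2) <= ce * (beta * `|r2| ^+ 2).
  have -> : (1 + kappa^-1) * (k1 ^+ 2 / kappa * (lambda^-1 * `|r2| ^+ 2)) +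
      KLs ^+ 2 * (lambda^-1 * `|r2| ^+ 2) =
    ((1 + kappa^-1) * (k1 ^+ 2 / kappa) + KLs ^+ 2) * (lambda^-1 * `|r2| ^+ 2).
    by ring.
  rewrite /ce -[leRHS]mulrA ler_pM2l//.
  by rewrite addr_gt0 ?exprn_gt0// !mulr_gt0 ?exprn_gt0.
have h5 : (1 + kappa^-1) * (k2 ^+ 2 * `|x.1 - yu| ^+ 2) + `|x.1 - yu| ^+ 2 <=
    cr * (alpha * `|r1| ^+ 2).
  have -> : (1 + kappa^-1) * (k2 ^+ 2 * `|x.1 - yu| ^+ 2) + `|x.1 - yu| ^+ 2 =
    ((1 + kappa^-1) * k2 ^+ 2 + 1) * `|x.1 - yu| ^+ 2 by ring.
  rewrite /cr -[leRHS]mulrA -[leRHS]mulrA ler_pM2l; last first.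
    by rewrite addr_gt0// mulr_gt0// exprn_gt0.
  by rewrite (le_trans D_le)// ler_pM2l// exprn_gt0.
rewrite mulrDr in young.
have h6 : 0 <= ce * (alpha * `|r1| ^+ 2) by rewrite mulr_ge0// ltW.
have h7 : 0 <= cr * (beta * `|r2| ^+ 2) by rewrite mulr_ge0// ltW.
by rewrite mulrDl !mulrDr; lra.
Qed.

Section solution.
Variables (lambda alpha beta K1 K2 : R) (f : Z) (zd : H).
Hypotheses (l0 : 0 < lambda) (l1 : lambda <= 1).
Hypotheses (al0 : 0 < alpha) (be0 : 0 < beta) (K10 : 0 < K1) (K20 : 0 < K2).

Local Notation N := (tnorm Xad A B C L Ls J Js lambda).
Local Notation b := (b_form Xad A B C L Ls J Js lambda alpha beta).
Local Notation m := (m_form Xad A B C L Ls J Js lambda alpha beta f zd).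
Local Notation solution :=
  (is_solution Xad A B C L Ls J Js lambda alpha beta f zd).

Hypotheses (b_le : forall x, b x x <= K1 * N x ^+ 2).
Hypotheses (b_ge : forall x, N x ^+ 2 <= K2 * b x x).

Let sbb : sym_bilinear b. Proof. exact: b_form_sym_bilinear. Qed.

(** Coercivity in the product norm of [Y * Ys], for a fixed parameter. *)
Lemma b_form_coercive : exists2 c : R, 0 < c &
  forall x : Y * Ys, c * `|x| ^+ 2 <= b x x.
Proof.
have [c c0 hc] := tnorm_definite l0 l1.
exists (K2 * c ^+ 2)^-1; first by rewrite invr_gt0 mulr_gt0// exprn_gt0.
move=> x; rewrite ler_pdivrMl; last by rewrite mulr_gt0// exprn_gt0.
apply: (@le_trans _ _ (c ^+ 2 * N x ^+ 2)).
  by rewrite -exprMn ler_pXn2r ?nnegrE// mulr_ge0 ?tnorm_ge0// ltW.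
by rewrite -[leRHS]mulrA [leRHS]mulrCA ler_pM2l ?exprn_gt0.
Qed.

Lemma solution_exists (S : set (Y * Ys)) :
  closed_subspace S -> exists x, solution S x.
Proof.
move=> hS; have [c c0 hc] := b_form_coercive.
have [M M0 hM] := residuals_bounded l0.
have [|||x hx] := @sym_lax_milgram R (Y * Ys)%type S b m c
  (alpha * M ^+ 2 + beta * M ^+ 2)
  (alpha * (`|f| * M) + beta * (`|adjoint A zd| * M)) hS sbb c0 hc.
- move=> x; have [h1 h2] := hM x; rewrite b_formE.
  have -> : (alpha * M ^+ 2 + beta * M ^+ 2) * `|x| ^+ 2 =
    alpha * (M * `|x|) ^+ 2 + beta * (M * `|x|) ^+ 2 by ring.
  by rewrite lerD// ler_pM2l// ler_pXn2r ?nnegrE// mulr_ge0// ltW.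
- by move=> a x y; exact: m_form_linear.
- move=> x; have [h1 h2] := hM x.
  rewrite (le_trans (ler_normD _ _))// mulrDl lerD// -!mulrA normrM gtr0_norm//.
    by rewrite ler_pM2l// (le_trans (cauchy_schwarz _ _))// ler_wpM2l.
  by rewrite ler_pM2l// (le_trans (cauchy_schwarz _ _))// normrN ler_wpM2l.
by exists x.
Qed.

Lemma solution_unique (S : set (Y * Ys)) x y : closed_subspace S ->
  solution S x -> solution S y -> x = y.
Proof.
move=> [_ Slin _] [Sx hx] [Sy hy]; have [c c0 hc] := b_form_coercive.
have Sxy : S (x - y) by rewrite addrC -scaleN1r; exact: Slin.
have := hc (x - y); rewrite (sbBl sbb) hx// hy// subrr pmulr_rle0// => le0.
apply/eqP; rewrite -subr_eq0 -normr_eq0 -sqrf_eq0 eq_le le0.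
exact: sqr_ge0.
Qed.

(** Galerkin orthogonality makes the discrete solution the best approximation
    in the energy norm. *)
Lemma quasi_optimal (S : set (Y * Ys)) x xh z : closed_subspace S ->
  solution setT x -> solution S xh -> S z ->
  N (x - xh) <= Num.sqrt (K1 * K2) * N (x - z).
Proof.
move=> [_ Slin _] [_ hx] [Sxh hxh] Sz.
have Sw : S (xh - z) by rewrite addrC -scaleN1r; exact: Slin.
have orth : b (x - xh) (xh - z) = 0 by rewrite (sbBl sbb) hx// hxh// subrr.
have best : b (x - xh) (x - xh) <= b (x - z) (x - z).
  have [c c0 hc] := b_form_coercive.
  have -> : x - z = (x - xh) + (xh - z) by rewrite addrA subrK.
  rewrite [leRHS](sb_sqrD sbb) orth mulr0 addr0 lerDl.
  by apply: le_trans (hc _); rewrite mulr_ge0 ?sqr_ge0// ltW.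
rewrite -(@ler_pXn2r _ 2) ?nnegrE ?mulr_ge0 ?tnorm_ge0 ?sqrtr_ge0//.
rewrite exprMn (@sqr_sqrtr _ (K1 * K2)); last by rewrite mulr_ge0// ltW.
rewrite (le_trans (b_ge _))// [K1 * K2]mulrC -mulrA ler_pM2l//.
exact: le_trans best (b_le _).
Qed.

End solution.

End control_problem.

Theorem theorem13 (R : realType) (H X Y Ys Z : hilbertType R)
  (n : nat) (d m : 'I_n -> nat) (Omega : forall j, set 'rV[R]_(d j))
  (hn : (0 < n)%N) (hd : forall j, (0 < d j)%N) (hm : forall j, (0 < m j)%N)
  (hOmega : forall j, lipschitz_domain (Omega j))
  (hZ : is_L2_product m Omega Z)
  (Xad : set X) (hXad : closed_subspace Xad)
  (A : {linear Z -> H}) (B : {linear X -> Z}) (C : {linear X -> X})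
  (hA : bounded_op A) (hB : bounded_op B) (hC : bounded_op C)
  (hCadj : adjoint C =1 C) (hCcoer : coercive_op C)
  (L : {linear Y -> Z}) (Ls : {linear Ys -> Z})
  (hL : bounded_op L) (hLs : bounded_op Ls)
  (hLbij : bijective L) (hLsbij : bijective Ls)
  (J : {linear Y -> Z}) (Js : {linear Ys -> Z})
  (hJ : bounded_op J) (hJs : bounded_op Js)
  (hLJ : forall y p, inner (L y) (Js p) = inner (J y) (Ls p))
  (a1 a2 b1 b2 : R) (ha1 : 0 < a1) (ha2 : 0 < a2) (hb1 : 0 < b1) (hb2 : 0 < b2) :
  exists2 K : R, 0 < K &
  forall (lambda alpha beta : R),
    0 < lambda <= 1 ->
    a1 <= alpha <= a2 ->
    b1 * lambda^-1 <= beta <= b2 * lambda^-1 ->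
  forall (f : Z) (zd : H) (Yh : set Y) (Yhs : set Ys),
    closed_subspace (Yh `*` Yhs) ->
    let solves := is_solution Xad A B C L Ls J Js lambda alpha beta f zd in
    let nrm := tnorm Xad A B C L Ls J Js lambda in
    [/\ exists! yp, solves setT yp,
        exists! yph, solves (Yh `*` Yhs) yph &
        forall yp yph, solves setT yp -> solves (Yh `*` Yhs) yph ->
          nrm (yp - yph) <= K * inf [set nrm (yp - zq) | zq in Yh `*` Yhs]].
Proof.
have [K1 [K2 [K10 K20 hK]]] := b_form_tnorm_equiv hXad hA hB hC hCadj hCcoer
  hL hLs hLbij hLsbij hJ hLJ ha1 ha2 hb1 hb2.
exists (Num.sqrt (K1 * K2)); first by rewrite sqrtr_gt0 mulr_gt0.
move=> lambda alpha beta hl hal hbe f zd Yh Yhs hYh solves nrm.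
have /andP[l0 l1] := hl; have /andP[al1 _] := hal; have /andP[be1 _] := hbe.
have al0 : 0 < alpha by exact: lt_le_trans al1.
have be0 : 0 < beta.
  by apply: lt_le_trans be1; rewrite mulr_gt0// invr_gt0.
have b_le x := (hK lambda alpha beta hl hal hbe x).1.
have b_ge x := (hK lambda alpha beta hl hal hbe x).2.
have exu S : closed_subspace S -> exists! x, solves S x.
  move=> hS; have [x hx] := solution_exists hXad hA hB hC hCadj hCcoer hL hLs
    hLbij hLsbij hJ hJs f zd l0 l1 al0 be0 K20 b_ge hS.
  exists x; split=> // y hy.
  exact: (solution_unique hXad hA hB hC hCadj hCcoer hL hLs
    hLbij hLsbij hJ l0 l1 K20 b_ge hS hx hy).
split; [exact/exu/closed_subspace_setT|exact: exu|].
move=> x xh hx hxh.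
have K0 : 0 < Num.sqrt (K1 * K2) by rewrite sqrtr_gt0 mulr_gt0.
rewrite -ler_pdivrMl//; apply: lb_le_inf.
  by exists (nrm (x - 0)), 0 => //; case: hYh.
move=> _ [z Sz <-]; rewrite ler_pdivrMl//.
exact: (quasi_optimal hXad hA hB hC hCadj hCcoer hL hLs
    hLbij hLsbij hJ l0 l1 K10 K20 b_le b_ge hYh hx hxh Sz).
Qed.
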